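(* Let $X$ be a finite set with $n\ge2$ elements, let $K_n$ be the complete directed graph (without self-loops) on $X$, let $G=(X,E)$ be a strongly connected subgraph of $K_n$ with vertex set $X$, and let $c$ be a distance on $X$. Then for every $b:X\to\mathbb{R}$ with $\sum_{x\in X}b(x)=0$ and $b\not\equiv0$, $$0\le\mathcal{E}_G(b)\le\Gamma_{G,c}.$$
   Context: For a directed graph $G=(V,E)$ without self-loops, a cost $c$ on edges with values in $[0,\infty)$, and $b:V\to\mathbb{R}$ with $\sum_{v\in V}b(v)=0$, a $b$-flow is a function $f:E\to[0,\infty)$ with $\sum_{v:(u,v)\in E}f(u,v)-\sum_{v:(v,u)\in E}f(v,u)=b(u)$ for all $u\in V$; $\mathcal{F}(G,b)$ is the set of $b$-flows, and $F_{G,c}(b)=\min_{f\in\mathcal{F}(G,b)}\sum_{(u,v)\in E}c(u,v)f(u,v)$. The relative approximation error is $$\mathcal{E}_G(b)=\frac{F_{G,c}(b)-F_{K_n,c}(b)}{F_{G,c}(b)}.$$ For $x,y\in X$, $c_G(x,y)$ denotes the minimum, over all directed paths in $G$ from $x$ to $y$, of the sum of the costs $c$ of the edges of the path, and $\Gamma_{G,c}=\max\{1-c(x,y)/c_G(x,y):\ (x,y)\in X^2,\ x\neq y\}$. *)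

(* Defs.v *)
From mathcomp Require Import all_boot all_order all_algebra.
From mathcomp Require Import all_classical all_reals.
Set Implicit Arguments.
Unset Strict Implicit.
Unset Printing Implicit Defensive.
Import Order.TTheory GRing.Theory Num.Theory.
Local Open Scope classical_set_scope.
Local Open Scope ring_scope.

(* The least (greatest) element of A: an element of A that is also a lower
   (upper) bound of A.  When A has no such element the value is the
   meaningless default 0; this never happens for the sets used below when the
   graph is strongly connected on at least two vertices, the cost is a
   distance and b sums to 0. *)
Definition set_min (R : realType) (A : set R) : R := xget 0 (A `&` lbound A).
Definition set_max (R : realType) (A : set R) : R := xget 0 (A `&` ubound A).

Lemma set_minE (R : realType) (A : set R) (m : R) :
  A m -> lbound A m -> set_min A = m.
Proof.
move=> Am lm; have [] : (A `&` lbound A) (set_min A) by apply: (@xgetI _ 0 _ m); split.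
by move=> Ax lx; apply/le_anti/andP; split; [exact: lx | exact: lm].
Qed.

Lemma set_maxE (R : realType) (A : set R) (m : R) :
  A m -> ubound A m -> set_max A = m.
Proof.
move=> Am um; have [] : (A `&` ubound A) (set_max A) by apply: (@xgetI _ 0 _ m); split.
by move=> Ax ux; apply/le_anti/andP; split; [exact: um | exact: ux].
Qed.

(* Directed graphs on the vertex set X are given by their edge relation
   e : rel X. *)
Definition complete_digraph (X : finType) : rel X := [rel x y | x != y].
Arguments complete_digraph X : clear implicits.

Definition strongly_connected (X : finType) (e : rel X) : Prop :=
  forall x y : X, connect e x y.

Definition is_distance (R : realType) (X : Type) (c : X -> X -> R) : Prop :=
  [/\ forall x y, 0 <= c x y,
      forall x y, c x y = 0 <-> x = y,
      forall x y, c x y = c y x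
    & forall x y z, c x z <= c x y + c y z].

(* A function E -> [0, +oo[ is encoded by its extension by zero to all ordered
   pairs of vertices, so that it is determined by its values on the edges. *)
Definition bflows (R : realType) (X : finType) (e : rel X) (b : X -> R) :
    set (X -> X -> R) :=
  [set f | [/\ forall u v, 0 <= f u v,
               forall u v, ~~ e u v -> f u v = 0
             & forall u, \sum_(v | e u v) f u v - \sum_(v | e v u) f v u
                         = b u]].

Definition flow_cost (R : realType) (X : finType) (e : rel X)
    (c f : X -> X -> R) : R :=
  \sum_(u : X) \sum_(v : X | e u v) c u v * f u v.

(* F_{G,c}(b) *)
Definition min_flow_cost (R : realType) (X : finType) (e : rel X)
    (c : X -> X -> R) (b : X -> R) : R :=
  set_min [set flow_cost e c f | f in bflows e b].

(* The relative approximation error of G. *)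
Definition rel_error (R : realType) (X : finType) (e : rel X)
    (c : X -> X -> R) (b : X -> R) : R :=
  (min_flow_cost e c b - min_flow_cost (complete_digraph X) c b)
  / min_flow_cost e c b.

(* The path with successive vertices x :: p. *)
Definition path_cost (R : realType) (X : Type) (c : X -> X -> R) (x : X)
    (p : seq X) : R :=
  \sum_(t <- pairmap c x p) t.

(* c_G(x, y).  Paths may repeat vertices; for nonnegative costs this does not
   change the minimum. *)
Definition graph_dist (R : realType) (X : finType) (e : rel X)
    (c : X -> X -> R) (x y : X) : R :=
  set_min [set path_cost c x p | p in [set p | path e x p /\ last x p = y]].

(* Gamma_{G,c} *)
Definition distortion (R : realType) (X : finType) (e : rel X)
    (c : X -> X -> R) : R :=
  set_max [set 1 - c xy.1 xy.2 / graph_dist e c xy.1 xy.2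
          | xy in [set xy : X * X | xy.1 != xy.2]].

(* Main.v *)
Require Import Defs.
From mathcomp Require Import all_boot all_order all_algebra.
From mathcomp Require Import all_classical all_reals.
From mathcomp Require Import ring lra.
Import Order.TTheory GRing.Theory Num.Theory.
Local Open Scope ring_scope.

(** Comparing G with the complete digraph K is done by transporting flows in
both directions.  A flow on G is already a flow on K of the same cost, whence
F_K <= F_G.  Conversely, an optimal flow h on K is pushed into G by sending the
amount h(x,y) along a shortest path of G from x to y
([route_along_shortest_paths]).  The result is a flow on G for the same b, of
cost the sum of c_G(x,y) h(x,y).  By definition of the distortion D, one has
(1 - D) c_G(x,y) <= c(x,y) for all x != y, so
  (1 - D) F_G <= (1 - D) sum c_G h <= sum c h = F_K,
which is the upper bound, once F_G > 0 is known: a flow for b != 0 uses some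
edge, and each edge has positive cost.

The remaining content is that the minima and the maximum in the definitions are
attained, as the default value of [set_min] and [set_max] carries no
information.  Each time, a finite family of candidates dominates everything
([set_minP]).  For paths, these are the paths without repeated vertices
([simple_path_cost_le]).  For flows, they are the vertices of the polyhedron of
flows, described here as the flows whose support carries no nonzero circulation
([irreducible_flow]): such a flow is determined by its support, and any flow
can be moved along circulations, without raising its cost, until its support
carries none ([irreducible_flow_exists]).  Finally, flows for b exist because
any b with sum zero can be routed through a single vertex ([bflow_exists]). *)

(** * Attained minima and maxima *)

Section SetExtrema.
Local Open Scope classical_set_scope.
Context {R : realType}.
Implicit Types A : set R.

(** A set of reals that need not be finite has a minimum as soon as finitely
many of its elements dominate all of it from below.  The values [g t] outside
[A] are ignored. *)
Lemma set_minP {T : finType} (g : T -> R) A :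
    A !=set0 -> (forall a, A a -> exists t, A (g t) /\ g t <= a) ->
  A (set_min A) /\ lbound A (set_min A).
Proof.
move=> [a0 Aa0] dom; have [t0 [At0 _]] := dom a0 Aa0.
have Pt0 : `[< A (g t0) >] by apply/asboolP.
case: (@Order.TotalTheory.arg_minP _ R T t0 (fun t => `[< A (g t) >]) g Pt0).
move=> t /asboolP At mint.
have lbt : lbound A (g t).
  move=> a /dom[s [As le_sa]]; apply: le_trans le_sa.
  by apply: mint; apply/asboolP.
by rewrite (set_minE At lbt).
Qed.

Lemma set_max_ub {T : finType} (P : pred T) (g : T -> R) t :
  P t -> g t <= set_max [set g s | s in [set s | P s]].
Proof.
move=> Pt; case: (@Order.TotalTheory.arg_maxP _ R T t P g Pt) => s Ps maxs.
rewrite (@set_maxE _ _ (g s)); [exact: maxs|by exists s|].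
by move=> _ [r Pr <-]; apply: maxs.
Qed.

End SetExtrema.

(** * Shortest paths *)

Section GraphDistance.
Local Open Scope classical_set_scope.
Context {R : realType} {X : finType}.
Variables (e : rel X) (c : X -> X -> R).

Lemma path_cost_cons x y p : path_cost c x (y :: p) = c x y + path_cost c y p.
Proof. by rewrite /path_cost /= big_cons. Qed.

Lemma path_cost_cat x p q :
  path_cost c x (p ++ q) = path_cost c x p + path_cost c (last x p) q.
Proof.
elim: p x => [|y p IHp] x /=; first by rewrite {2}/path_cost big_nil add0r.
by rewrite !path_cost_cons IHp addrA.
Qed.

Hypothesis c_ge0 : forall x y, 0 <= c x y.

Lemma path_cost_ge0 x p : 0 <= path_cost c x p.
Proof.
elim: p x => [|y p IHp] x; first by rewrite /path_cost big_nil.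
by rewrite path_cost_cons addr_ge0.
Qed.

(** Cutting out a cycle cannot raise the cost, since costs are nonnegative.  In
the induction, the tail has already been made simple; if it comes back to [x],
only its part after that visit is kept. *)
Lemma simple_path_cost_le x p : path e x p ->
  exists q, [/\ path e x q, last x q = last x p, uniq (x :: q)
              & path_cost c x q <= path_cost c x p].
Proof.
elim: p x => [|y p IHp] x /=; first by exists [::].
case/andP=> exy /IHp[q [eq lq uq le_qp]].
have [xq|xq] := boolP (x \in y :: q); last first.
  exists (y :: q); split; rewrite //= ?exy //; first by rewrite xq.
  by rewrite !path_cost_cons lerD2l.
case/splitPl: xq eq lq uq le_qp => q1 q2 lq1.
rewrite cat_path lq1 last_cat lq1 -cat_cons path_cost_cat lq1.
move=> /andP[_ eq2] lq2 uq le_qp; exists q2; split=> //.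
  move: uq; rewrite cat_uniq => /and3P[_ /hasPn disj ->].
  rewrite andbT; apply/negP => /disj /negP; apply.
  by rewrite -lq1 mem_last.
rewrite path_cost_cons; apply: le_trans (le_trans _ le_qp) _.
  by rewrite lerDr path_cost_ge0.
by rewrite lerDr.
Qed.

(** A path without repetition has at most [#|X|] vertices, so the bounded
sequences over [X] are a finite family containing all the candidates. *)
Lemma graph_distP x y : connect e x y ->
  exists p, [/\ path e x p, last x p = y & path_cost c x p = graph_dist e c x y].
Proof.
move=> /connectP[p0 ep0 lp0].
set A : set R := [set path_cost c x p | p in [set p | path e x p /\ last x p = y]].
suff [[p [ep lp] cp] _] : A (set_min A) /\ lbound A (set_min A) by exists p.
apply: (@set_minP _ {bseq #|X| of X} (fun p => path_cost c x p)) => [|a [p [ep lp] <-]].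
  by exists (path_cost c x p0), p0.
have [q [eq lq uq le_qp]] := simple_path_cost_le _ _ ep.
have sq : (size q <= #|X|)%N.
  by apply: ltnW; apply: leq_trans (max_card (mem (x :: q))); rewrite (card_uniqP uq).
exists (Bseq sq); split=> //=; exists q => //; split=> //.
by rewrite lq.
Qed.

End GraphDistance.

Lemma path_cost_ge_dist (R : realType) (X : finType) (c : X -> X -> R) x p :
  is_distance c -> c x (last x p) <= path_cost c x p.
Proof.
case=> c_ge0 c_eq0 _ c_tri; elim: p x => [|y p IHp] x /=.
  by rewrite (c_eq0 x x).2 // path_cost_ge0.
by rewrite path_cost_cons; apply: le_trans (c_tri _ y _) _; rewrite lerD2l.
Qed.

(** * Flows of least cost *)

Section Flows.
Local Open Scope classical_set_scope.
Context {R : realType} {X : finType}.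
Implicit Types (e : rel X) (f g z c : X -> X -> R) (b : X -> R).

(** Sums over all ordered pairs, rather than over the edges of a graph: for
flows, which vanish off the edges, both agree, and the same formulas then serve
G and the complete digraph. *)
Definition net_outflow f u : R := \sum_v f u v - \sum_v f v u.
Definition total_cost c f : R := \sum_u \sum_v c u v * f u v.

Lemma sum_over_edges (P : pred X) (F : X -> R) :
  (forall v, ~~ P v -> F v = 0) -> \sum_(v | P v) F v = \sum_v F v.
Proof.
by move=> F0; rewrite [RHS](bigID P) /= [X in _ + X]big1 ?addr0.
Qed.

Lemma bflowsE e b f : bflows e b f <->
  [/\ forall u v, 0 <= f u v, forall u v, ~~ e u v -> f u v = 0
    & forall u, net_outflow f u = b u].
Proof.
by split=> -[f_ge0 f0 fb]; split=> // u; rewrite -fb /net_outflow;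
  rewrite (sum_over_edges (e u)) 1?(sum_over_edges (fun v => e v u)) // => v /f0.
Qed.

Lemma flow_costE e c b f : bflows e b f -> flow_cost e c f = total_cost c f.
Proof.
case=> _ f0 _; apply: eq_bigr => u _; apply: sum_over_edges => v /f0 ->.
by rewrite mulr0.
Qed.

Lemma net_outflowD f g (a : R) u :
  net_outflow (fun x y => f x y + a * g x y) u
  = net_outflow f u + a * net_outflow g u.
Proof. by rewrite /net_outflow !big_split /= -!mulr_sumr; ring. Qed.

Lemma total_costD c f g (a : R) :
  total_cost c (fun x y => f x y + a * g x y)
  = total_cost c f + a * total_cost c g.
Proof.
rewrite /total_cost mulr_sumr -big_split; apply: eq_bigr => u _ /=.
rewrite mulr_sumr -big_split; apply: eq_bigr => v _ /=; ring.
Qed.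

Lemma net_outflow_sum (I : finType) (a : I -> R) (F : I -> X -> X -> R) u :
  net_outflow (fun x y => \sum_i a i * F i x y) u
  = \sum_i a i * net_outflow (F i) u.
Proof.
rewrite /net_outflow exchange_big [X in _ - X]exchange_big /=.
rewrite -sumrB; apply: eq_bigr => i _.
by rewrite -!mulr_sumr mulrBr.
Qed.

Lemma total_cost_sum c (I : finType) (a : I -> R) (F : I -> X -> X -> R) :
  total_cost c (fun x y => \sum_i a i * F i x y)
  = \sum_i a i * total_cost c (F i).
Proof.
rewrite /total_cost; under eq_bigr => u _.
  under eq_bigr => v _ do rewrite mulr_sumr.
  rewrite exchange_big; over.
rewrite exchange_big; apply: eq_bigr => i _ /=.
rewrite mulr_sumr; apply: eq_bigr => u _; rewrite mulr_sumr.
by apply: eq_bigr => v _; rewrite mulrCA.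
Qed.

(** No nonzero circulation lives on the support of [f].  For a flow, this says
that it is a vertex of the polyhedron of flows, or that its support is a
forest. *)
Definition irreducible_flow f := forall z,
  (forall u v, f u v = 0 -> z u v = 0) -> (forall u, net_outflow z u = 0) ->
  forall u v, z u v = 0.

Lemma irreducible_flow_inj e b f g : bflows e b f -> bflows e b g ->
  irreducible_flow f -> (forall u v, (f u v == 0) = (g u v == 0)) -> f = g.
Proof.
move=> /bflowsE[_ _ fb] /bflowsE[_ _ gb] f_irr same_supp.
apply/funext => u; apply/funext => v.
suff /(_ u v) : forall u v, f u v + (-1) * g u v = 0.
  by move=> /eqP; rewrite mulN1r subr_eq0 => /eqP.
apply: f_irr => [x y fxy|x]; last by rewrite net_outflowD fb gb; ring.
by have /eqP -> : g x y == 0 by [rewrite -same_supp fxy]; rewrite fxy mulr0 addr0.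
Qed.

(** The step is the ratio test of the simplex method: the largest [a] for which
[f + a z] is still nonnegative is the least ratio [f / - z] over the pairs where
[z < 0], and the pair [(x, y)] that attains it leaves the support. *)
Lemma bflow_cancel e b f z u0 v0 : bflows e b f ->
    (forall u v, f u v = 0 -> z u v = 0) -> (forall u, net_outflow z u = 0) ->
    z u0 v0 < 0 ->
  exists a x y, [/\ 0 <= a, bflows e b (fun u v => f u v + a * z u v),
                    f x y != 0 & f x y + a * z x y = 0].
Proof.
move=> /bflowsE[f_ge0 f0 fb] zf z0 zneg.
case: (@Order.TotalTheory.arg_minP _ R _ (u0, v0) (fun t => z t.1 t.2 < 0)
  (fun t => f t.1 t.2 / - z t.1 t.2) zneg) => -[x y] /= zxy mina.
have nz : 0 < - z x y by rewrite oppr_gt0.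
exists (f x y / - z x y), x, y; split.
- by rewrite divr_ge0 // ltW.
- apply/bflowsE; split=> [u v|u v /f0 fuv|u].
  + have [zuv|zuv] := ltP (z u v) 0; last first.
      by rewrite addr_ge0 // mulr_ge0 // divr_ge0 // ltW.
    have := mina (u, v) zuv; rewrite /= [leRHS]/(_ / _) ler_pdivlMr ?oppr_gt0 //.
    by rewrite mulrN -subr_ge0 opprK.
  + by rewrite fuv (zf _ _ fuv) mulr0 addr0.
  + by rewrite net_outflowD fb z0 mulr0 addr0.
- by apply: contraTneq zxy => /zf ->; rewrite ltxx.
- by rewrite invrN mulrN mulNr divfK ?subrr // lt_eqF.
Qed.

(** Induction on the size of the support.  A circulation [z] on the support is
replaced by its opposite if necessary, so as to have cost at most zero and a
negative entry: then moving along it empties a pair of the support and does not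
raise the cost.  If [z] is nonnegative, so is its cost, and [- z] qualifies
because [z] is nonzero; symmetrically if [- z] is nonnegative; and if both have
negative entries, one of them has cost at most zero. *)
Lemma irreducible_flow_exists e c b f : (forall u v, 0 <= c u v) ->
    bflows e b f ->
  exists g, [/\ bflows e b g, irreducible_flow g
              & total_cost c g <= total_cost c f].
Proof.
move=> c_ge0; have [n] := ubnP #|[pred t | f t.1 t.2 != 0]|.
elim: n f => // n IHn f; rewrite ltnS => le_n fP.
have [f_irr|] := pselect (irreducible_flow f); first by exists f.
move=> /existsNP[z /not_implyP[zf /not_implyP[z0 /existsNP[u /existsNP[v zuv]]]]].
have [w [wf w0 [x [y wxy]] cw]] : exists w,
  [/\ forall u v, f u v = 0 -> w u v = 0, forall u, net_outflow w u = 0,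
      exists x y, w x y < 0 & total_cost c w <= 0].
  pose opp_z x y := 0 + (-1) * z x y.
  have ozf x y : f x y = 0 -> opp_z x y = 0 by rewrite /opp_z => /zf ->; ring.
  have oz0 x : net_outflow opp_z x = 0.
    by rewrite net_outflowD z0 /net_outflow !big1 //; ring.
  have cost_opp : total_cost c opp_z = - total_cost c z.
    rewrite total_costD {1}/total_cost big1 => [|x _]; first by ring.
    by rewrite big1 // => y _; rewrite mulr0.
  have cost_ge0 w : ~ (exists x y, w x y < 0) -> 0 <= total_cost c w.
    move=> w_ge0; apply: sumr_ge0 => x _; apply: sumr_ge0 => y _.
    rewrite mulr_ge0 // leNgt; apply/negP => wxy; apply: w_ge0.
    by exists x, y.
  have [zneg|z_ge0] := pselect (exists x y, z x y < 0); last first.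
    exists opp_z; split=> //; last by rewrite cost_opp oppr_le0 cost_ge0.
    exists u, v; rewrite /opp_z add0r mulN1r oppr_lt0 lt_neqAle eq_sym.
    rewrite (introN eqP zuv) leNgt; apply/negP => zuv_lt0.
    by apply: z_ge0; exists u, v.
  have [zpos|/cost_ge0] := pselect (exists x y, opp_z x y < 0); last first.
    by rewrite cost_opp oppr_ge0 => cz; exists z.
  have [cz|/ltW cz] := leP (total_cost c z) 0; first by exists z.
  by exists opp_z; rewrite cost_opp oppr_le0.
have [a [x' [y' [a_ge0 gP fxy gxy]]]] := bflow_cancel _ _ _ _ _ _ fP wf w0 wxy.
have [|g [gP' g_irr le_g]] := IHn _ _ gP.
  apply: leq_trans le_n; apply: proper_card; apply/properP; split.
    apply/fintype.subsetP=> t; rewrite !inE; apply: contraNneq => ft.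
    by rewrite wf // ft mulr0 addr0.
  by exists (x', y'); rewrite !inE /= ?gxy ?eqxx.
exists g; split=> //; apply: le_trans le_g _.
by rewrite total_costD gerDl mulr_ge0_le0.
Qed.

(** An irreducible flow is determined by its support, so the set of zeros of a
flow, of which there are finitely many, indexes the candidates. *)
Lemma min_flow_costP e c b : (forall u v, 0 <= c u v) ->
    (exists f, bflows e b f) ->
  (exists2 f, bflows e b f & min_flow_cost e c b = total_cost c f)
  /\ forall f, bflows e b f -> min_flow_cost e c b <= total_cost c f.
Proof.
move=> c_ge0 [f0 f0P].
pose A : set R := [set flow_cost e c f | f in bflows e b].
suff [[f fP cf] lbA] : A (set_min A) /\ lbound A (set_min A).
  split=> [|g gP]; first by exists f; rewrite // -(flow_costE _ _ _ _ fP).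
  by rewrite -(flow_costE e c b g gP); apply: lbA; exists g.
pose I (S : {set X * X}) := [set f | [/\ bflows e b f, irreducible_flow f
  & forall u v, ((u, v) \in S) = (f u v == 0)]].
apply: (@set_minP _ {set X * X}
          (fun S => flow_cost e c (xget (fun _ _ => 0) (I S)))).
  by exists (flow_cost e c f0), f0.
move=> _ [f fP <-].
have [g [gP g_irr le_gf]] := irreducible_flow_exists _ _ _ _ c_ge0 fP.
pose S := [set t | g t.1 t.2 == 0]%SET.
have IS : I S g by split=> // u v; rewrite inE.
exists S; case: xgetP => [h _ [hP h_irr hS]|/(_ g)//].
have -> : h = g.
  by apply: irreducible_flow_inj hP gP h_irr _ => u v; rewrite -hS inE.
by split; [exists g | rewrite !(flow_costE _ _ b)].
Qed.

End Flows.

(** * Routing flows along paths *)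

Section Routing.
Local Open Scope classical_set_scope.
Context {R : realType} {X : finType}.
Implicit Types (e : rel X) (f g c : X -> X -> R) (b : X -> R).

(** A path may use an edge several times, hence a count rather than an
indicator function. *)
Fixpoint path_flow (x : X) (p : seq X) (u v : X) : R :=
  if p is y :: q then ((u, v) == (x, y))%:R + path_flow y q u v else 0.

Lemma path_flow_bflow e x p : path e x p ->
  bflows e (fun u => (u == x)%:R - (u == last x p)%:R) (path_flow x p).
Proof.
move=> ep; apply/bflowsE; split=> [u v|u v|u].
- by elim: p x {ep} => //= y p IHp x; rewrite addr_ge0.
- elim: p x ep => //= y p IHp x /andP[exy ep] /[dup] /IHp -> //.
  by rewrite addr0; case: eqP => // -[-> ->]; rewrite exy.
- rewrite /net_outflow; elim: p x {ep} => [|y p IHp] x /=.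
    by rewrite !big1 // !subrr.
  rewrite !big_split /=.
  have sum_delta (w t : X) : \sum_v (v == w)%:R * (u == t)%:R = (u == t)%:R :> R.
    by rewrite -mulr_suml (bigD1 w) //= eqxx big1 ?addr0 ?mul1r // => v /negPf ->.
  under eq_bigr => v _ do rewrite xpair_eqE andbC -mulnb natrM.
  rewrite sum_delta.
  under [X in _ - (X + _)]eq_bigr => v _ do rewrite xpair_eqE -mulnb natrM.
  by rewrite sum_delta -(addrA (u == x)%:R); have := IHp y; lra.
Qed.

Lemma path_flow_cost c x p : total_cost c (path_flow x p) = path_cost c x p.
Proof.
elim: p x => [|y p IHp] x /=.
  rewrite /path_cost big_nil /total_cost big1 // => u _.
  by rewrite big1 // => v _; rewrite mulr0.
rewrite path_cost_cons -IHp /total_cost.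
have -> : c x y = \sum_u \sum_v c u v * ((u, v) == (x, y))%:R.
  rewrite (bigD1 x) //= (bigD1 y) //= eqxx mulr1 !big1 ?addr0 // => [u|v] nu.
    by rewrite big1 // => v _; rewrite xpair_eqE (negPf nu) mulr0.
  by rewrite xpair_eqE (negPf nu) andbF mulr0.
rewrite -big_split; apply: eq_bigr => u _; rewrite -big_split.
by apply: eq_bigr => v _; rewrite mulrDr.
Qed.

(** Each unit of [f x y] is sent along a shortest path from [x] to [y], which
has the same net outflow as a single arc from [x] to [y].  The matrix [f] is
arbitrary, diagonal included: the path from [x] to itself is empty and costs
nothing. *)
Lemma route_along_shortest_paths e c f : (forall x y, 0 <= c x y) ->
    strongly_connected e -> (forall x y, 0 <= f x y) ->
  exists2 g, bflows e (net_outflow f) g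
           & total_cost c g = total_cost (graph_dist e c) f.
Proof.
move=> c_ge0 hconn f_ge0.
have /choice[p pP] : forall t : X * X, exists p, [/\ path e t.1 p,
    last t.1 p = t.2 & path_cost c t.1 p = graph_dist e c t.1 t.2].
  by move=> t; apply: graph_distP.
have flowP t : bflows e (fun u => (u == t.1)%:R - (u == t.2)%:R)
                        (path_flow t.1 (p t)).
  by have [ep lp _] := pP t; rewrite -[in X in bflows _ X]lp; exact: path_flow_bflow.
exists (fun u v => \sum_t f t.1 t.2 * path_flow t.1 (p t) u v).
  apply/bflowsE; split=> [u v|u v nuv|u].
  - apply: sumr_ge0 => t _; rewrite mulr_ge0 //.
    by have /bflowsE[] := flowP t.
  - by apply: big1 => t _; have /bflowsE[_ -> //] := flowP t; rewrite mulr0.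
  - rewrite net_outflow_sum.
    under eq_bigr => t _ do [have /bflowsE[_ _ ->] := flowP t; rewrite mulrBr].
    rewrite sumrB /net_outflow.
    rewrite -(pair_bigA _ (fun x y => f x y * (u == x)%:R)) /=.
    rewrite -(pair_bigA _ (fun x y => f x y * (u == y)%:R)) /=.
    rewrite [X in _ - X]exchange_big /=.
    congr (_ - _); rewrite (bigD1 u) //= eqxx [X in _ + X]big1 ?addr0.
    + by apply: eq_bigr => v _; rewrite mulr1.
    + by move=> x /negPf nx; apply: big1 => v _; rewrite eq_sym nx mulr0.
    + by apply: eq_bigr => v _; rewrite mulr1.
    + by move=> x /negPf nx; apply: big1 => v _; rewrite eq_sym nx mulr0.
rewrite total_cost_sum [RHS]/total_cost pair_big; apply: eq_bigr => t _ /=.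
by rewrite path_flow_cost; have [_ _ ->] := pP t; rewrite mulrC.
Qed.

(** All the supply, the positive part of [b], is sent to [r], and all the
demand, the negative part, is served from [r]; supply and demand have the same
total, so that [r] is in balance. *)
Lemma bflow_exists e b (r : X) : strongly_connected e -> \sum_x b x = 0 ->
  exists f, bflows e b f.
Proof.
move=> hconn hb.
pose bp x := Num.max (b x) 0; pose bm x := Num.max (- b x) 0.
have b_split x : b x = bp x - bm x.
  by rewrite /bp /bm; case: (leP (b x) 0); case: (leP (- b x) 0); lra.
have sum_bpm : \sum_x bp x = \sum_x bm x.
  apply/eqP; rewrite -subr_eq0 -sumrB; apply/eqP; rewrite -[RHS]hb.
  by apply: eq_bigr => x _; rewrite b_split.
pose f x y := bp x * (y == r)%:R + (x == r)%:R * bm y.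
have f_ge0 x y : 0 <= f x y.
  by rewrite addr_ge0 // mulr_ge0 // le_max lexx orbT.
have [g gP _] := route_along_shortest_paths _ (fun _ _ => 0) _
  (fun _ _ => lexx _) hconn f_ge0.
suff <- : net_outflow f = b by exists g.
apply/funext => u; rewrite /net_outflow !big_split /= -!mulr_sumr -!mulr_suml.
have -> : \sum_v (v == r)%:R = 1 :> R.
  by rewrite (bigD1 r) //= eqxx big1 ?addr0 // => v /negPf ->.
by rewrite sum_bpm b_split; ring.
Qed.

End Routing.

(** * The relative error is bounded by the distortion *)

Theorem proposition4p3 (R : realType) (X : finType) (hX : (2 <= #|X|)%N)
    (e : rel X) (he : subrel e (complete_digraph X))
    (hconn : strongly_connected e)
    (c : X -> X -> R) (hc : is_distance c)
    (b : X -> R) (hb : \sum_(x : X) b x = 0) (hb0 : exists x : X, b x != 0) :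
  0 <= rel_error e c b /\ rel_error e c b <= distortion e c.
Proof.
have [c_ge0 c_eq0 _ _] := hc; have [r br] := hb0.
have dist_gt0 x y : x != y -> 0 < graph_dist e c x y.
  move=> nxy; have [p [_ lp <-]] := graph_distP e c c_ge0 _ _ (hconn x y).
  apply: lt_le_trans (path_cost_ge_dist _ _ _ _ _ hc); rewrite lp.
  by rewrite lt_def c_ge0 andbT; apply: contraNneq nxy => /c_eq0 ->.
have [fG fGP] := bflow_exists _ _ r hconn hb.
have bflowsK f : bflows e b f -> bflows (complete_digraph X) b f.
  move=> /bflowsE[f_ge0 f0 fb]; apply/bflowsE; split=> // u v nuv.
  by apply: f0; apply: contraNN nuv => /he.
have [[g gP cg] minG] := min_flow_costP e c b c_ge0 (ex_intro _ _ fGP).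
have [[h hP ch] minK] := min_flow_costP (complete_digraph X) c b c_ge0
  (ex_intro _ _ (bflowsK _ fGP)).
have G_gt0 : 0 < min_flow_cost e c b.
  have /bflowsE[g_ge0 g0 gb] := gP.
  have cg_ge0 u v : 0 <= c u v * g u v by rewrite mulr_ge0.
  rewrite cg lt_def andbC sumr_ge0 => [/=|u _]; last exact: sumr_ge0.
  apply: contra_neqN br => /eqP cost0.
  suff g_eq0 u v : g u v = 0 by rewrite -gb /net_outflow !big1 ?subrr.
  have [euv|/g0//] := boolP (e u v).
  have row0 : \sum_w c u w * g u w = 0.
    by apply: (psumr_eq0P _ cost0) => // x _; apply: sumr_ge0.
  have /eqP : c u v * g u v = 0 by apply: (psumr_eq0P _ row0).
  rewrite mulf_eq0 => /orP[/eqP/c_eq0 uv|/eqP//].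
  by have := he _ _ euv; rewrite uv /complete_digraph /= eqxx.
rewrite /rel_error; split.
  by rewrite divr_ge0 ?(ltW G_gt0) // subr_ge0 cg; apply: minK; apply: bflowsK.
rewrite ler_pdivrMr //.
have /bflowsE[h_ge0 h0 hnet] := hP.
have [k kP ck] := route_along_shortest_paths e c h c_ge0 hconn h_ge0.
have {}kP : bflows e b k.
  by have -> : b = net_outflow h by apply/funext => u; rewrite hnet.
set G := min_flow_cost e c b in G_gt0 *; set D := distortion e c.
suff : (1 - D) * G <= total_cost c h by rewrite ch; lra.
(* Multiplying by [1 - D] preserves order only if [D <= 1]; otherwise the left
   side is negative. *)
have [D_gt1|D_le1] := ltP 1 D.
  apply: (@le_trans _ _ 0).
    by rewrite pmulr_lle0 // subr_le0 ltW.
  by apply: sumr_ge0 => u _; apply: sumr_ge0 => v _; rewrite mulr_ge0.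
have le_dist u v : (1 - D) * (graph_dist e c u v * h u v) <= c u v * h u v.
  have [<-|nuv] := eqVneq u v; first by rewrite h0 ?mulr0 // /complete_digraph /= eqxx.
  rewrite mulrA ler_wpM2r // -ler_pdivlMr ?dist_gt0 // lerBlDr -lerBlDl.
  exact: (set_max_ub (fun xy : X * X => xy.1 != xy.2)
           (fun xy => 1 - c xy.1 xy.2 / graph_dist e c xy.1 xy.2) (u, v)).
apply: (@le_trans _ _ ((1 - D) * total_cost c k)).
  by rewrite ler_wpM2l ?subr_ge0 // minG.
rewrite ck /total_cost mulr_sumr; apply: ler_sum => u _.
by rewrite mulr_sumr; apply: ler_sum => v _.
Qed.
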